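(* Let $S$ be a set of places of $\mathbb{Q}$, $X$ the set of places of $\overline{\mathbb{Q}}$ dividing a place in $S$, $\mathcal L=LC_c(X)$ equipped with the norm $\|f\|_{\mathcal L}=\int_X|f|\,d\lambda$, and $\mathcal L'$ the space of continuous linear functionals on $\mathcal L$. Let $\mathcal J'=\{c\in\mathcal J^*: c(K,v)/\lambda(K,v) \text{ is bounded for }(K,v)\in\mathcal J\}$. Then the map $\Phi':\mathcal J'\to\mathcal L'$, $\Phi'(c)=\Phi_c$, is a vector space isomorphism from $\mathcal J'$ to $\mathcal L'$.
   Context: Fix an algebraic closure $\overline{\mathbb{Q}}$; number fields lie inside it. For a number field $K$ and place $v$ of $K$, $K_v$ is the completion and $\mathbb{Q}_v$ the completion of $\mathbb{Q}$ at the place below $v$. $Y$ is the set of all places of $\overline{\mathbb{Q}}$ and $Y(K,v)=\{y\in Y:y\mid v\}$; $Y$ has the topology with basis $\{Y(K,v)\}$, and $\lambda$ is the regular Borel measure on $Y$ with $\lambda(Y(K,v))=[K_v:\mathbb{Q}_v]/[K:\mathbb{Q}]$; $X\subseteq Y$ carries the subspace topology and the restriction of $\lambda$. $M_K(S)$ is the set of places of $K$ dividing a place of $S$, and $\mathcal J=\{(K,v): K \text{ a number field},\ v\in M_K(S)\}$. A map $c:\mathcal J\to\mathbb{R}$ is consistent if $c(K,v)=\sum_{w\mid v}c(L,w)$ for all $(K,v)\in\mathcal J$ and all finite extensions $L/K$; $\mathcal J^*$ is the real vector space of consistent maps. Also write $\lambda(K,v)=[K_v:\mathbb{Q}_v]/[K:\mathbb{Q}]$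 for $(K,v)\in\mathcal J$. $LC_c(X)$ is the space of locally constant, compactly supported real functions on $X$. For each $f\in LC_c(X)$ there is a number field $K$ with $f$ constant on each $Y(K,v)$, $v\in M_K(S)$, with value $f(v)$ zero for all but finitely many $v$; for consistent $c$, $\Phi_c(f)=\sum_{v\in M_K(S)}c(K,v)f(v)$, independent of such $K$. *)

(* Defs.v *)
From HB Require Import structures.
From mathcomp Require Import all_boot all_order all_algebra all_field.
From mathcomp Require Import all_classical all_reals all_analysis Rstruct.

Set Implicit Arguments.
Unset Strict Implicit.
Unset Printing Implicit Defensive.

Import Order.TTheory GRing.Theory Num.Theory.
Local Open Scope classical_set_scope.
Local Open Scope ring_scope.

Notation RR := Rdefinitions.R.

(** A (candidate) absolute value is a real function on algC; only its values
    on the field under consideration matter. *)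
Definition absv := algC -> RR.

Definition is_absval (K : set algC) (a : absv) : Prop :=
  [/\ (forall x, K x -> 0 <= a x),
      (forall x, K x -> (a x = 0 <-> x = 0)),
      (forall x y, K x -> K y -> a (x * y) = a x * a y),
      (forall x y, K x -> K y -> a (x + y) <= a x + a y) &
      (exists x, [/\ K x, x != 0 & a x != 1])].

Definition equiv_abs (K : set algC) (a b : absv) : Prop :=
  exists t : RR, 0 < t /\ forall x, K x -> b x = a x `^ t.

Definition is_place (K : set algC) (v : set absv) : Prop :=
  exists a, is_absval K a /\ v = [set b | is_absval K b /\ equiv_abs K a b].

(** w | v : the restriction to the smaller field of (an absolute value in) w
    lies in v *)
Definition lies_over (w v : set absv) : Prop := exists b, w b /\ v b.

Definition Qfield : set algC := [set x | x \in Crat].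
Definition Qbar : set algC := setT.

Definition is_subfield (K : set algC) : Prop :=
  [/\ K 0, K 1,
      (forall x y, K x -> K y -> K (x - y)),
      (forall x y, K x -> K y -> K (x * y)) &
      (forall x, K x -> x != 0 -> K x^-1)].

Definition Qcomb (s : seq algC) (q : 'I_(size s) -> rat) : algC :=
  \sum_(i < size s) ratr (q i) * s`_i.

Definition Qspan (s : seq algC) : set algC :=
  [set x | exists q, x = @Qcomb s q].

Definition Qindep (s : seq algC) : Prop :=
  forall q, @Qcomb s q = 0 -> forall i, q i = 0.

Definition is_number_field (K : set algC) : Prop :=
  is_subfield K /\ exists s : seq algC, {subset s <= K} /\ K `<=` Qspan s.

Definition degree (K : set algC) : nat :=
  xget 0%N [set n | exists s : seq algC,
    [/\ {subset s <= K}, K = Qspan s, Qindep s & size s = n]].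

(** [K_v : Q_v]: the dimension over Q_v of the completion K_v.  Since K is
    dense in K_v, x_1..x_n in K are Q_v-linearly independent in K_v iff the
    Q_v-linear map Q_v^n -> K_v they define is bounded below, i.e. iff
    |sum q_i x_i|_a >= eps * max_i |q_i|_a for all q in Q^n (a in v);
    and K_v is spanned by K, so the dimension is the maximal such n. *)
Definition Qv_indep (a : absv) (s : seq algC) : Prop :=
  exists eps : RR, 0 < eps /\
    forall q : 'I_(size s) -> rat,
      eps * \big[Num.max/0]_(i < size s) a (ratr (q i)) <= a (@Qcomb s q).

Definition local_degree (K : set algC) (v : set absv) : nat :=
  xget 0%N [set n |
    (exists a s, [/\ v a, {subset s <= K}, Qv_indep a s & size s = n]) /\
    (forall a s, v a -> {subset s <= K} -> Qv_indep a s -> (size s <= n)%N)].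

Definition lamKv (K : set algC) (v : set absv) : RR :=
  (local_degree K v)%:R / (degree K)%:R.

(** The space Y of places of Qbar is carried by the type [set absv]
    (its elements that are places of Qbar). *)
Definition Yt := set absv.

Definition Ykv (v : set absv) : set Yt :=
  [set y | is_place Qbar y /\ lies_over y v].

Definition basic : set (set Yt) :=
  [set U | exists K v, [/\ is_number_field K, is_place K v & U = Ykv v]].

Definition openY (U : set Yt) : Prop :=
  forall y, U y -> exists B, [/\ basic B, B y & B `<=` U].

Definition compactY (A : set Yt) : Prop :=
  forall F : set (set Yt), (forall U, F U -> openY U) ->
    A `<=` \bigcup_(U in F) U ->
    exists G, [/\ G `<=` F, finite_set G & A `<=` \bigcup_(U in G) U].

Section WithS.
Variable S : set (set absv). (* a set of places of Q *)

Definition Xs : set Yt :=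
  [set y | is_place Qbar y /\ exists u, S u /\ lies_over y u].

Definition closureX (A : set Yt) : set Yt :=
  [set x | Xs x /\ forall B, basic B -> B x -> exists y, [/\ Xs y, B y & A y]].

(** LC_c(X): functions on X (extended by 0 outside X) that are locally
    constant and have compact support. *)
Definition inL (f : Yt -> RR) : Prop :=
  [/\ (forall y, ~ Xs y -> f y = 0),
      (forall x, Xs x -> exists U, [/\ basic U, U x &
          forall y, Xs y -> U y -> f y = f x]) &
      compactY (closureX [set x | Xs x /\ f x != 0])].

Definition inJ (K : set algC) (v : set absv) : Prop :=
  [/\ is_number_field K, is_place K v & exists u, S u /\ lies_over v u].

Definition consistent (c : set algC -> set absv -> RR) : Prop :=
  forall K v L, inJ K v -> is_number_field L -> K `<=` L ->
    c K v = \sum_(w \in [set w | inJ L w /\ lies_over w v]) c L w.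

(** J' (maps are compared only on J) *)
Definition inJ' (c : set algC -> set absv -> RR) : Prop :=
  consistent c /\
  exists M : RR, forall K v, inJ K v -> `|c K v / lamKv K v| <= M.

Definition fval (f : Yt -> RR) (v : set absv) : RR :=
  xget 0 [set r | exists y, Ykv v y /\ Xs y /\ f y = r].

Definition adapted (K : set algC) (f : Yt -> RR) : Prop :=
  [/\ is_number_field K,
      (forall v, inJ K v -> forall y z, Ykv v y -> Ykv v z -> Xs y -> Xs z ->
          f y = f z) &
      finite_set [set v | inJ K v /\ fval f v != 0]].

Definition PhiVal (c : set algC -> set absv -> RR) (f : Yt -> RR) (r : RR) :=
  exists K, adapted K f /\
    r = \sum_(v \in [set v | inJ K v]) c K v * fval f v.

Definition Phi (c : set algC -> set absv -> RR) (f : Yt -> RR) : RR :=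
  xget 0 (PhiVal c f).

(** measurable structure on Y: sigma-algebra generated by the basis
    (= Borel, the basis being countable) *)
Definition Ymeas := g_sigma_algebraType basic.

Definition normL (lam : {measure set Ymeas -> \bar RR}) (f : Yt -> RR) : RR :=
  fine (\int[lam]_(y in (Xs : set Ymeas)) (`|f y|)%:E)%E.

Definition linL (phi : (Yt -> RR) -> RR) : Prop :=
  forall f g a b, inL f -> inL g ->
    phi (fun y => a * f y + b * g y) = a * phi f + b * phi g.

Definition contL (lam : {measure set Ymeas -> \bar RR}) (phi : (Yt -> RR) -> RR)
  : Prop :=
  forall f, inL f -> forall eps : RR, 0 < eps -> exists delta : RR, 0 < delta /\
    forall g, inL g -> normL lam (fun y => g y - f y) < delta ->
      `|phi g - phi f| < eps.

End WithS.

(* Main.v *)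
Require Import Defs.
From HB Require Import structures.
From mathcomp Require Import all_boot all_order all_algebra all_field.
From mathcomp Require Import finmap all_classical all_reals all_analysis Rstruct.
From mathcomp Require Import measurable_realfun lra.
Import Order.TTheory GRing.Theory Num.Theory.
Local Open Scope classical_set_scope.
Local Open Scope ring_scope.

Set Implicit Arguments.
Unset Strict Implicit.
Unset Printing Implicit Defensive.

(* Because lies_over w v amounts to inclusion w `<=` v of places, the sets Ykv v
   behave like a tree of balls.  The local degree is at least 1, so Ykv v has
   positive measure: it is nonempty, and since it has finite measure only finitely
   many places of a given finite extension lie over v.  Konig's lemma along a
   tower of number fields exhausting the countable field algC then gives
   compactness of Ykv v, the limit absolute value being glued from
   representatives normalised on the bottom field.  So LC_c(X) is spanned by the
   indicators of the Ykv v, Phi_c sends the indicator of Ykv v to c(K,v), and the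
   L^1-norm of a sum of such indicators over one field is weighted by lambda(K,v):
   boundedness of c / lambda is exactly continuity of Phi_c. *)

(** A place contains every power of an absolute value that still obeys the triangle inequality, so
    members of nested places need not agree on the smaller field, and gluing along a tower needs a
    rigid choice. Prescribing the value [a] on the bottom field gives one: two members of one place
    differ by an exponent, and nontriviality of [a] forces it to be 1. Such a member exists because
    a power of an absolute value is again one as soon as it is at most n on each natural number n.
    Nontriviality is also part of [is_absval], so restriction to a subfield stays inside the notion
    only because everything is algebraic: this is what turns [lies_over] into inclusion. The
    extension of a place to [Qbar] and the finiteness of the places above a given one, usually
    theorems of valuation theory, are here read off from the values of [lam]. *)

Lemma subfieldD K x y : is_subfield K -> K x -> K y -> K (x + y).
Proof.
case=> K0 _ KB _ _ Kx Ky; rewrite -[y]opprK; apply: (KB) => //.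
by rewrite -[- y]sub0r; apply: KB.
Qed.

Lemma subfieldX K x n : is_subfield K -> K x -> K (x ^+ n).
Proof.
case=> _ K1 _ KM _ Kx; elim: n => [|n IH]; first by rewrite expr0.
by rewrite exprS; apply: KM.
Qed.

Lemma subfield_nat K n : is_subfield K -> K n%:R.
Proof.
move=> sK; case: (sK) => K0 K1 _ _ _.
elim: n => // n IH; rewrite -natr1; exact: subfieldD.
Qed.

Lemma subfield_sum K n (F : 'I_n -> algC) :
  is_subfield K -> (forall i, K (F i)) -> K (\sum_i F i).
Proof.
move=> sK KF; apply: (big_ind K) => //; first by case: sK.
by move=> x y; apply: subfieldD.
Qed.

Lemma subfield_ratr K q : is_subfield K -> K (ratr q).
Proof.
move=> sK; case: (sK) => K0 K1 KB KM KV.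
have Kint m : K (m%:~R).
  case: m => n; first by rewrite -pmulrn; apply: subfield_nat.
  by rewrite NegzE mulrNz -sub0r -pmulrn; apply: KB => //; apply: subfield_nat.
rewrite /ratr; apply: KM; first exact: Kint.
by apply: KV; [exact: Kint | rewrite intr_eq0 denq_neq0].
Qed.

Lemma Qfield_sub K : is_subfield K -> Qfield `<=` K.
Proof. by move=> sK x /CratP[q ->]; apply: subfield_ratr. Qed.

Lemma subfield_Qfield : is_subfield Qfield.
Proof.
rewrite /Qfield; split => /=; rewrite ?rpred0 ?rpred1 //.
- by move=> x y *; rewrite rpredB.
- by move=> x y *; rewrite rpredM.
- by move=> x *; rewrite rpredV.
Qed.

Lemma subfield_Qbar : is_subfield Qbar. Proof. by []. Qed.

(** * Absolute values: basic rules, restriction to a subfield, real powers *)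

Section Absval.
Variables (K : set algC) (a : absv).
Hypotheses (sK : is_subfield K) (aK : is_absval K a).

Lemma absval_ge0 x : K x -> 0 <= a x. Proof. by case: aK => h ? ? ? ?; apply: h. Qed.

Lemma absval0 : a 0 = 0.
Proof. by case: aK => _ h _ _ _; apply/(h 0) => //; case: sK. Qed.

Lemma absval_gt0 x : K x -> x != 0 -> 0 < a x.
Proof.
move=> Kx x0; rewrite lt_def absval_ge0 // andbT.
by case: aK => _ h _ _ _; apply: contra_neq x0 => /(h x Kx).
Qed.

Lemma absvalM x y : K x -> K y -> a (x * y) = a x * a y.
Proof. by case: aK => _ _ h _ _; apply: h. Qed.

Lemma absvalD x y : K x -> K y -> a (x + y) <= a x + a y.
Proof. by case: aK => _ _ _ h _; apply: h. Qed.

Lemma absval1 : a 1 = 1.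
Proof.
have K1 : K 1 by case: sK.
have a1 : a 1 != 0 by rewrite gt_eqF // absval_gt0 // oner_neq0.
by apply: (mulfI a1); rewrite -absvalM // !mulr1.
Qed.

Lemma absvalV x : K x -> x != 0 -> a x^-1 = (a x)^-1.
Proof.
move=> Kx x0; have KV : K x^-1 by case: sK => _ _ _ _; apply.
have ax0 : a x != 0 by rewrite gt_eqF // absval_gt0.
by apply: (mulfI ax0); rewrite -absvalM // !divff // absval1.
Qed.

Lemma absvalX x n : K x -> a (x ^+ n) = a x ^+ n.
Proof.
move=> Kx; elim: n => [|n IH]; first by rewrite !expr0 absval1.
by rewrite !exprS absvalM ?IH //; apply: subfieldX.
Qed.

Lemma absval_sum n (F : 'I_n -> algC) :
  (forall i, K (F i)) -> a (\sum_i F i) <= \sum_i a (F i).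
Proof.
move=> KF.
have : K (\sum_i F i) /\ a (\sum_i F i) <= \sum_i a (F i).
  apply: (big_ind2 (fun x y => K x /\ a x <= y)).
  - by rewrite absval0; case: sK.
  - move=> x1 x2 y1 y2 [? ?] [? ?]; split; first exact: subfieldD.
    by apply: le_trans (absvalD _ _) _ => //; apply: lerD.
  - by move=> i _; split.
by case.
Qed.

Lemma absval_nat n : a n%:R <= n%:R.
Proof.
elim: n => [|n IH]; first by rewrite absval0.
rewrite -!natr1; apply: le_trans (absvalD _ _) _.
- exact: subfield_nat.
- by case: sK.
- by rewrite absval1 lerD2r.
Qed.

End Absval.

Lemma bernoulli (r : RR) n : 1 < r -> 1 + n%:R * (r - 1) <= r ^+ n.
Proof.
move=> r1; have d0 : 0 < r - 1 by lra.
elim: n => [|n IH]; first by rewrite mul0r addr0 expr0.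
rewrite exprSr -natr1.
have : (1 + n%:R * (r - 1)) * r <= r ^+ n * r by rewrite ler_pM2r //; lra.
have : 0 <= n%:R * ((r - 1) * (r - 1)).
  by apply: mulr_ge0 => //; apply: mulr_ge0; apply: ltW.
lra.
Qed.

Lemma nat_unbounded (C : RR) : exists n : nat, C < n%:R.
Proof.
have /archi_boundP := normr_ge0 C; set N := Num.bound _ => hN; exists N.
exact: le_lt_trans (ler_norm _) hN.
Qed.

Lemma expr_unbounded (r C : RR) : 1 < r -> exists n, C < r ^+ n.
Proof.
move=> r1; have d0 : 0 < r - 1 by lra.
have [N hN] := nat_unbounded (C / (r - 1)).
exists N; apply: lt_le_trans (bernoulli N r1).
move: hN; rewrite ltr_pdivrMr // => hN; lra.
Qed.

(* The powers of x span a finite-dimensional Q-space, so b cannot be trivial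
   on Q and unbounded on the powers of x. *)
Lemma absval_sub K L b :
  is_subfield K -> is_subfield L -> K `<=` L -> is_absval L b -> is_absval K b.
Proof.
move=> sK sL KL bL; case: (bL) => h1 h2 h3 h4 [x [Lx x0 bx]].
split; try by move=> *; auto.
apply: contrapT => triv.
have tr z : K z -> z != 0 -> b z = 1.
  move=> Kz z0; apply: contrapT => /eqP bz; apply: triv; exists z; split => //.
wlog bx1 : x Lx x0 bx / 1 < b x.
  move=> wl; case: (ltgtP (b x) 1) bx => // bx1 _; last first.
    by apply: (wl x) => //; rewrite gt_eqF.
  have Lv : L x^-1 by case: sL => _ _ _ _; apply.
  have bv : 1 < b x^-1.
    by rewrite (absvalV sL bL) // invf_gt1 // (absval_gt0 bL).
  by apply: (wl x^-1) => //; rewrite ?invr_eq0 // gt_eqF.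
have [p [_ monp] rp] := minCpolyP x.
have rpx : root (map_poly ratr p) x by rewrite rp dvdpp.
pose C := \sum_(i < size p) b x ^+ i.
have bound k : b x ^+ k <= C.
  have -> : b x ^+ k = b (x ^+ k) by rewrite (absvalX sL bL).
  have -> : x ^+ k = \sum_(i < size p) ratr (('X^k %% p)`_i) * x ^+ i.
    have /(congr1 (fun q => (map_poly (ratr : rat -> algC) q).[x])) := divp_eq 'X^k p.
    rewrite map_polyXn hornerXn rmorphD rmorphM /= hornerD hornerM.
    rewrite (rootP rpx) mulr0 add0r => ->.
    rewrite (@horner_coef_wide _ (size p)); last first.
      rewrite size_map_poly ltnW // ltn_modp; exact: monic_neq0.
    by apply: eq_bigr => i _; rewrite coef_map.
  apply: le_trans (absval_sum sL bL _) _.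
    by move=> i; case: (sL) => _ _ _ LM _; apply: LM;
       [exact: subfield_ratr | exact: subfieldX].
  apply: ler_sum => i _; rewrite h3; [|exact: subfield_ratr|exact: subfieldX].
  rewrite (absvalX sL bL) // ler_piMl ?exprn_ge0 ?h1 //.
  have [->|q0] := eqVneq ('X^k %% p)`_i 0.
    by rewrite rmorph0 (absval0 sL bL).
  by rewrite tr // ?fmorph_eq0 //; apply: subfield_ratr.
have [n] := expr_unbounded C bx1.
by rewrite ltNge bound.
Qed.

Lemma exprn_powR (x s : RR) n : 0 <= x -> (x ^+ n) `^ s = (x `^ s) ^+ n.
Proof.
move=> x0; elim: n => [|n IH]; first by rewrite !expr0 powR1.
by rewrite !exprS powRM ?exprn_ge0 // IH.
Qed.

Lemma powRK (x s : RR) : 0 <= x -> s != 0 -> (x `^ s) `^ s^-1 = x.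
Proof. by move=> x0 s0; rewrite -powRrM divff // powRr1. Qed.

Lemma ler_powR2r (x y s : RR) : 0 <= s -> 0 <= x -> x <= y -> x `^ s <= y `^ s.
Proof.
move=> s0 x0 xy; apply: ge0_ler_powR => //; rewrite nnegrE //.
exact: le_trans xy.
Qed.

Lemma powR_eq_self (x s : RR) : 0 < x -> x != 1 -> x `^ s = x -> s = 1.
Proof.
move=> x0 x1 /(congr1 (@ln _)); rewrite ln_powR => h.
have lx : ln x != 0 by rewrite ln_eq0.
by apply: (mulIf lx); rewrite mul1r.
Qed.

(** The n-th root of n + 1 tends to 1. In elementary form: if the ratio [q] of [x] to [z] exceeded
    1, the square of Bernoulli's bound would make q^(2m) grow quadratically in m, against the linear
    bound 2m + 1. *)
Lemma ler_of_exprn (x z : RR) :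
  0 <= x -> 0 <= z -> (forall n, x ^+ n <= n.+1%:R * z ^+ n) -> x <= z.
Proof.
move=> x0 z0 h; rewrite leNgt; apply/negP => zx.
have [z_0|zn0] := eqVneq z 0.
  by have := h 1%N; rewrite z_0 !expr1 mulr0 leNgt -z_0 zx.
have zp : 0 < z by rewrite lt_def zn0.
pose q := x / z; have q1 : 1 < q by rewrite ltr_pdivlMr // mul1r.
have hq n : q ^+ n <= n.+1%:R.
  by rewrite expr_div_n ler_pdivrMr ?exprn_gt0.
have d0 : 0 < q - 1 by lra.
(* With d = q - 1 this choice gives m d^2 > 2, hence (1 + m d)^2 > 1 + 2m, which contradicts [hq] at
   the exponent 2m. *)
have [m hm] := nat_unbounded (2 / ((q - 1) * (q - 1))).
have := hq (m * 2)%N; rewrite exprM -natr1 natrM.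
have := bernoulli m q1.
move: hm; rewrite ltr_pdivrMr ?mulr_gt0 //.
set M := m%:R; set Q := q ^+ m; set d := q - 1 => hm h1 h2.
have M0 : 0 <= M by [].
have Md : 0 <= M * d by apply: mulr_ge0 => //; apply: ltW.
have hsq : (1 + M * d) ^+ 2 <= Q ^+ 2 by rewrite ler_sqr ?nnegrE //; lra.
have : 2 * M <= M * (M * (d * d)) by rewrite mulrC ler_wpM2l // ltW.
have Mp : 0 < M.
  rewrite lt_def M0 andbT; apply/eqP => M_0; move: hm; rewrite M_0 mul0r; lra.
have : 2 * M < M * (M * (d * d)) by rewrite [2 * M]mulrC ltr_pM2l.
have := Md; rewrite /d in hsq *; nra.
Qed.

(* Comparing both sides of the binomial expansion of (x + y)^n and letting n
   grow shows that the bound on the integers alone forces the triangle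
   inequality. *)
Lemma absval_pow K b (s : RR) :
  is_subfield K -> is_absval K b -> 0 < s ->
  (forall n : nat, b n%:R `^ s <= n%:R) -> is_absval K (fun x => b x `^ s).
Proof.
move=> sK bK s0 bn; case: (bK) => b0 bE bM bD [z [Kz z0 bz]].
have sN : s != 0 by rewrite gt_eqF.
split.
- by move=> x _; apply: powR_ge0.
- move=> x Kx; rewrite -(bE x Kx); split=> [/eqP|->]; last by rewrite powR0.
  by rewrite powR_eq0 sN andbT => /eqP.
- by move=> x y Kx Ky; rewrite bM // powRM ?b0.
- move=> x y Kx Ky; set S := (X in _ <= X).
  have S0 : 0 <= S by rewrite addr_ge0 ?powR_ge0.
  have Kxy : K (x + y) by apply: subfieldD.
  suff h : b (x + y) <= S `^ s^-1.
    have := ler_powR2r (ltW s0) (b0 _ Kxy) h.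
    by rewrite -powRrM mulVf // powRr1.
  apply: ler_of_exprn (b0 _ Kxy) (powR_ge0 _ _) _ => n.
  rewrite -(absvalX sK bK) // exprDn.
  have KT (i : 'I_n.+1) : K ((x ^+ (n - i) * y ^+ i) *+ 'C(n, i)).
    rewrite -mulr_natr; case: (sK) => _ _ _ KM _.
    by apply: (KM); [apply: (KM); exact: subfieldX | exact: subfield_nat].
  apply: le_trans (absval_sum sK bK KT) _.
  rewrite -[in X in _ <= X](card_ord n.+1) mulr_natl -sumr_const.
  apply: ler_sum => i _; rewrite -exprn_powR //.
  rewrite -[X in X <= _](powRK (b0 _ (KT i)) sN).
  apply: ler_powR2r; rewrite ?powR_ge0 ?invr_ge0 ?(ltW s0) //.
  have KX m u : K u -> K (u ^+ m) by move=> Ku; apply: subfieldX.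
  have KM u w : K u -> K w -> K (u * w) by case: (sK) => _ _ _ h _; apply: h.
  have Kn := subfield_nat 'C(n, i) sK.
  rewrite -mulr_natr !bM ?(absvalX sK bK) //; do ?[exact: KX | apply: KM => //].
  rewrite !powRM ?mulr_ge0 ?exprn_ge0 ?b0 //.
  (* The s-th power of one binomial term is at most the matching term in the expansion of S^n,
     because [b] of the binomial coefficient, raised to s, is at most the coefficient; the other
     terms of S^n are nonnegative. *)
  rewrite !exprn_powR ?b0 // /S exprDn (bigD1 i) //= -[X in X <= _]addr0.
  apply: lerD.
    rewrite -[X in _ <= X]mulr_natr; apply: ler_wpM2l => //.
    by rewrite mulr_ge0 // exprn_ge0 // powR_ge0.
  apply: sumr_ge0 => j _; rewrite mulrn_wge0 // mulr_ge0 // exprn_ge0 //;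
    exact: powR_ge0.
- exists z; split => //; apply: contra_neq bz => bz1.
  by have := powRK (b0 _ Kz) sN; rewrite bz1 powR1.
Qed.

(** * Places as equivalence classes, and their restriction to subfields *)

Lemma equiv_abs_refl K a : is_absval K a -> equiv_abs K a a.
Proof.
by move=> aK; exists 1; split => // x Kx; rewrite powRr1 // (absval_ge0 aK).
Qed.

Lemma equiv_abs_sym K a b : is_absval K a -> equiv_abs K a b -> equiv_abs K b a.
Proof.
move=> aK [t [t0 h]]; exists t^-1; rewrite invr_gt0; split => // x Kx.
by rewrite h // powRK ?gt_eqF // (absval_ge0 aK).
Qed.

Lemma equiv_abs_trans K a b c :
  equiv_abs K a b -> equiv_abs K b c -> equiv_abs K a c.
Proof.
move=> [t [t0 h]] [s [s0 h']]; exists (t * s); rewrite mulr_gt0 //; split=> //.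
by move=> x Kx; rewrite h' // h // powRrM.
Qed.

Lemma equiv_abs_sub K L a b : K `<=` L -> equiv_abs L a b -> equiv_abs K a b.
Proof. by move=> KL [t [t0 h]]; exists t; split=> // x /KL; apply: h. Qed.

Definition place_of (K : set algC) (a : absv) : set absv :=
  [set b | is_absval K b /\ equiv_abs K a b].

Lemma is_place_of K a : is_absval K a -> is_place K (place_of K a).
Proof. by exists a. Qed.

Lemma place_of_self K a : is_absval K a -> place_of K a a.
Proof. by move=> aK; split => //; apply: equiv_abs_refl. Qed.

Lemma place_mem K v b : is_place K v -> v b -> is_absval K b.
Proof. by move=> [a [_ ->]] []. Qed.

Lemma place_neq0 K v : is_place K v -> exists a, v a.
Proof. by move=> [a [aK ->]]; exists a; apply: place_of_self. Qed.

Lemma place_equiv K v a b : is_place K v -> v a -> v b -> equiv_abs K a b.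
Proof.
move=> [c [cK ->]] [aK ca] [bK cb]; apply: equiv_abs_trans cb.
exact: equiv_abs_sym.
Qed.

Lemma place_closed K v a b :
  is_place K v -> v a -> is_absval K b -> equiv_abs K a b -> v b.
Proof.
move=> [c [cK ->]] [aK ca] bK ab; split => //.
exact: equiv_abs_trans ab.
Qed.

Lemma place_inter K v w b :
  is_place K v -> is_place K w -> v b -> w b -> v = w.
Proof.
move=> pv pw vb wb; apply/seteqP; split=> c hc.
  by apply: (place_closed pw wb); [exact: place_mem hc | exact: place_equiv hc].
by apply: (place_closed pv vb); [exact: place_mem hc | exact: place_equiv hc].
Qed.

Section LiesOver.
Variables (K L : set algC) (v w : set absv).
Hypotheses (sK : is_subfield K) (sL : is_subfield L) (KL : K `<=` L).
Hypotheses (pv : is_place K v) (pw : is_place L w).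

(** One common member suffices: any other member of [w] is a power of [b] on [L], hence on [K], and
    by [absval_sub] it stays nontrivial there. *)
Lemma lies_over_sub b : w b -> v b -> w `<=` v.
Proof.
move=> wb vb c wc; apply: (place_closed pv vb).
  by apply: (absval_sub sK sL KL); apply: place_mem wc.
by apply: equiv_abs_sub KL _; apply: place_equiv wc.
Qed.

Lemma lies_overE : lies_over w v <-> w `<=` v.
Proof.
split=> [[b [wb vb]]|wv]; first exact: lies_over_sub wb vb.
by have [b wb] := place_neq0 pw; exists b; split => //; apply: wv.
Qed.

End LiesOver.

Lemma exists_restriction K L w :
  is_subfield K -> is_subfield L -> K `<=` L -> is_place L w ->
  exists v, is_place K v /\ w `<=` v.
Proof.
move=> sK sL KL pw; have [b wb] := place_neq0 pw.
have bK : is_absval K b by apply: absval_sub KL _ => //; apply: place_mem wb.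
exists (place_of K b); split; first exact: is_place_of.
by apply: (lies_over_sub sK sL KL _ pw wb);
  [exact: is_place_of | exact: place_of_self].
Qed.

(** * Linear algebra over the rationals inside [algC] *)

Section NumberFieldModel.
Variables (Qs : fieldExtType rat) (QsC : {rmorphism Qs -> algC}).

(** Spans and independence in [algC] are transported from an abstract number field [Qs], where the
    theory of finite-dimensional vector spaces applies. Coefficients are indexed by [nat] because
    [l] and [map QsC l] have different ordinal index types. *)
Lemma Qcomb_map (l : seq Qs) (q : nat -> rat) :
  Qcomb (fun i : 'I_(size (map QsC l)) => q i) =
  QsC (\sum_(i < size l) q i *: l`_i).
Proof.
rewrite /Qcomb rmorph_sum /= size_map; apply: eq_bigr => i _.
by rewrite rmorphZ_num (nth_map 0).
Qed.

Lemma ord_fun_ext n (q : 'I_n -> rat) :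
  q = fun i : 'I_n => oapp q 0 (insub (nat_of_ord i)).
Proof. by apply/funext => i; rewrite valK. Qed.

Lemma Qspan_map (l : seq Qs) : Qspan (map QsC l) = QsC @` [set` << l >>%VS].
Proof.
apply/seteqP; split=> x.
  move=> [q ->]; rewrite [q]ord_fun_ext.
  pose q' i := oapp q 0 (insub i); rewrite (Qcomb_map l q').
  exists (\sum_(i < size l) q' i *: l`_i) => //=.
  apply: memv_suml => i _; apply: memvZ; apply: memv_span.
  exact: mem_nth.
move=> [v /= vl <-]; have := coord_span (vl : v \in << in_tuple l >>%VS).
pose q i := coord (in_tuple l) i v => ->.
exists (fun i => oapp q 0 (insub (nat_of_ord i))).
rewrite (Qcomb_map l (fun i => oapp q 0 (insub i))); congr (QsC _).
by apply: eq_bigr => i _; rewrite valK.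
Qed.

Lemma Qindep_map (l : seq Qs) : Qindep (map QsC l) <-> free l.
Proof.
split=> [ind|].
  rewrite -[l]/(val (in_tuple l)); apply/freeP => k hk i.
  pose q j := oapp k 0 (insub j).
  have hi : (i < size (map QsC l))%N by rewrite size_map.
  have /(_ _ (Ordinal hi)) := ind (fun j => q (nat_of_ord j)).
  rewrite /= /q valK; apply.
  rewrite (Qcomb_map l q) (_ : \sum_(i < _) _ = 0) ?rmorph0 // -[RHS]hk.
  by apply: eq_bigr => j _; rewrite /q valK.
rewrite -{1}[l]/(val (in_tuple l)) => /freeP fr q.
rewrite [q]ord_fun_ext; set q' := fun i => oapp q 0 (insub i).
rewrite (Qcomb_map l q') => /eqP; rewrite fmorph_eq0 => /eqP h i.
have hi : (i < size l)%N by have := ltn_ord i; rewrite {2}size_map.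
exact: (fr (fun j => q' (nat_of_ord j)) h (Ordinal hi)).
Qed.

End NumberFieldModel.

Lemma Qspan_sub K s : is_subfield K -> {subset s <= K} -> Qspan s `<=` K.
Proof.
move=> sK Ks x [q ->]; apply: subfield_sum => // i.
case: (sK) => _ _ _ KM _; apply: KM; first exact: subfield_ratr.
by have /Ks := mem_nth 0 (ltn_ord i); rewrite inE.
Qed.

Lemma number_field_span K :
  is_number_field K -> exists s, {subset s <= K} /\ K = Qspan s.
Proof.
move=> [sK [s [Ks h]]]; exists s; split => //; apply/seteqP; split => //.
exact: Qspan_sub.
Qed.

Lemma number_field_basis K : is_number_field K ->
  exists s, [/\ {subset s <= K}, K = Qspan s & Qindep s].
Proof.
move=> /number_field_span[s [Ks Ksp]].
have [Qs [QsC [s1 s1s _]]] := num_field_exists s.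
have bE : << vbasis << s1 >> >>%VS = << s1 >>%VS := span_basis (vbasisP _).
have KE : K = Qspan (map QsC (vbasis << s1 >>%VS)).
  by rewrite Qspan_map bE -Qspan_map s1s.
exists (map QsC (vbasis << s1 >>%VS)); split => //; last first.
  by apply/Qindep_map; apply: basis_free (vbasisP _).
move=> _ /mapP[v vb ->]; rewrite inE KE Qspan_map; exists v => //=.
exact: memv_span.
Qed.

(** Steinitz bound: both lists are pulled back to the number field generated by [t], where the
    dimension of a span is at most the length of the list. *)
Lemma Qindep_size s t : Qindep s -> {subset s <= Qspan t} -> (size s <= size t)%N.
Proof.
have [Qs [QsC [t1 <- _]]] := num_field_exists t => ind st.
have [s1 s1t s1s] : exists2 s1, {subset s1 <= << t1 >>%VS} & map QsC s1 = s.
  elim: s st {ind} => [|x s IH] st; first by exists [::].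
  have [|s1 s1t s1s] := IH; first by move=> y ys; apply: st; rewrite inE ys orbT.
  have := st x (mem_head _ _); rewrite inE Qspan_map => -[v /= vt vx].
  exists (v :: s1); last by rewrite /= vx s1s.
  by move=> y; rewrite inE => /orP[/eqP->|/s1t].
move: ind; rewrite -s1s Qindep_map /free => /eqP dim.
rewrite !size_map -dim; apply: leq_trans (dim_span t1).
by apply/dimvS/span_subvP.
Qed.

Lemma number_field_of_seq (s : seq algC) :
  exists L, is_number_field L /\ {subset s <= L}.
Proof.
have [Qs [QsC [s1 s1s _]]] := num_field_exists s.
exists (range QsC); split; last first.
  by rewrite -s1s => _ /mapP[v _ ->]; rewrite inE; exists v.
split.
  split.
  - by exists 0; rewrite ?rmorph0.
  - by exists 1; rewrite ?rmorph1.
  - by move=> _ _ [x _ <-] [y _ <-]; exists (x - y); rewrite ?rmorphB.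
  - by move=> _ _ [x _ <-] [y _ <-]; exists (x * y); rewrite ?rmorphM.
  - by move=> _ [x _ <-] _; exists x^-1; rewrite ?fmorphV.
exists (map QsC (vbasis {:Qs}%VS)); split.
  by move=> _ /mapP[v _ ->]; rewrite inE; exists v.
by rewrite Qspan_map => _ [x _ <-]; exists x; rewrite //= (span_basis (vbasisP _)) memvf.
Qed.

(** The extra list [s] lets the tower in [compact_Ykv] absorb one more algebraic number at each
    step. *)
Lemma compositum K L (s : seq algC) : is_number_field K -> is_number_field L ->
  exists M, [/\ is_number_field M, K `<=` M, L `<=` M & {subset s <= M}].
Proof.
move=> /number_field_span[sK [_ ->]] /number_field_span[sL [_ ->]].
have [M [nM h]] := number_field_of_seq (sK ++ sL ++ s).
exists M; split => //; try apply: Qspan_sub; try by case: nM.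
- by move=> x xs; apply: h; rewrite mem_cat xs.
- by move=> x xs; apply: h; rewrite !mem_cat xs orbT.
- by move=> x xs; apply: h; rewrite !mem_cat xs !orbT.
Qed.

(** * Positivity of the degrees and of the weights [lamKv] *)

Lemma degree_gt0 K : is_number_field K -> (0 < degree K)%N.
Proof.
move=> nK; have [s0 [s0K s0sp s0i]] := number_field_basis nK.
rewrite /degree; set D := (X in xget _ X).
have [|s [sK Ksp _ <-]] := @xgetPex _ 0%N D; first by exists (size s0), s0.
have K1 : K 1 by case: nK => -[].
rewrite lt0n; apply/negP => /nilP s_0.
move: K1; rewrite Ksp s_0 => -[q]; rewrite /Qcomb big_ord0 => /eqP.
by rewrite oner_eq0.
Qed.

Lemma Qv_indep_Qindep K a s :
  is_subfield K -> is_absval K a -> Qv_indep a s -> Qindep s.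
Proof.
move=> sK aK [e [e0 h]] q q0 i.
have := h q; rewrite q0 (absval0 sK aK) pmulr_rle0 // => m0.
have ai : a (ratr (q i)) <= 0.
  exact: le_trans (le_bigmax 0 (fun i => a (ratr (q i))) i) m0.
apply/eqP; apply: contraTT ai => qi; rewrite -ltNge; apply: (absval_gt0 aK).
  exact: subfield_ratr.
by rewrite fmorph_eq0.
Qed.

(** The default 0 of [local_degree] has to be excluded, so a maximal length must exist: lists
    independent over Q_v are independent over Q, hence no longer than a spanning list [t], and the
    list with the single element 1 is independent with constant 1. *)
Lemma local_degree_gt0 K v :
  is_number_field K -> is_place K v -> (0 < local_degree K v)%N.
Proof.
move=> nK pv; have [t [_ Kt]] := number_field_span nK.
have sK : is_subfield K by case: nK.
pose P n := `[< exists a s, [/\ v a, {subset s <= K}, Qv_indep a s & size s = n] >].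
have [a va] := place_neq0 pv.
have P1 : P 1%N.
  apply/asboolP; exists a, [:: 1]; split => //.
    by move=> x; rewrite !inE => /eqP ->; case: sK.
  exists 1; split => // q.
  by rewrite mul1r /Qcomb !big_ord_recl !big_ord0 /= mulr1 addr0 ge_max lexx
    (absval_ge0 (place_mem pv va)) //; apply: subfield_ratr.
have Pb n : P n -> (n <= size t)%N.
  move=> /asboolP[b [s [vb sKs /(Qv_indep_Qindep sK (place_mem pv vb)) ind <-]]].
  by apply: Qindep_size ind _; rewrite -Kt.
have [m Pm mmax] := ex_maxnP (ex_intro (fun n => is_true (P n)) _ P1) Pb.
rewrite /local_degree; set D := (X in xget _ X).
have [|_ h] := @xgetPex _ 0%N D.
  exists m; split; first exact/asboolP.
  by move=> b s vb sKs ind; apply: mmax; apply/asboolP; exists b, s.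
by have /asboolP[b [s [vb sKs ind sz]]] := P1; rewrite -sz; apply: h ind.
Qed.

(** The bound depends on [K] only; this uniformity in [v] is what limits the number of places in
    [finite_above]. *)
Lemma lamKv_lb K v : is_number_field K -> is_place K v ->
  (degree K)%:R^-1 <= lamKv K v.
Proof.
move=> nK pv; rewrite /lamKv ler_peMl ?invr_ge0 //.
by rewrite ler1n local_degree_gt0.
Qed.

Lemma lamKv_gt0 K v : is_number_field K -> is_place K v -> 0 < lamKv K v.
Proof.
move=> nK pv; apply: lt_le_trans (lamKv_lb nK pv).
by rewrite invr_gt0 ltr0n degree_gt0.
Qed.

Lemma subfield_nf K : is_number_field K -> is_subfield K. Proof. by case. Qed.

(** * The balls [Ykv v] and finite covers *)

Lemma Ykv_sub v w : w `<=` v -> Ykv w `<=` Ykv v.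
Proof. by move=> wv y [py [b [yb wb]]]; split => //; exists b; split=> //; apply: wv. Qed.

Lemma Ykv_over K v y : is_number_field K -> is_place K v ->
  Ykv v y -> y `<=` v.
Proof.
move=> /subfield_nf sK pv [py [b [yb vb]]].
exact: (lies_over_sub sK subfield_Qbar _ pv py yb vb).
Qed.

(** An absolute value in the common place [y] belongs to both [v] and [w], so balls over nested
    fields are nested as soon as they meet. *)
Lemma Ykv_meet K L v w y : is_number_field K -> is_number_field L ->
  K `<=` L -> is_place K v -> is_place L w -> Ykv v y -> Ykv w y -> w `<=` v.
Proof.
move=> nK nL KL pv pw yv yw; have [b yb] : exists b, y b by case: yv => /place_neq0.
apply: (lies_over_sub (subfield_nf nK) (subfield_nf nL) KL pv pw (b := b)).
  exact: (Ykv_over nL pw yw yb).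
exact: (Ykv_over nK pv yv yb).
Qed.

Lemma Ykv_inj K v w y : is_number_field K -> is_place K v -> is_place K w ->
  Ykv v y -> Ykv w y -> v = w.
Proof.
move=> nK pv pw yv yw; have [b yb] : exists b, y b by case: yv => /place_neq0.
by apply: (place_inter pv pw (b := b));
  [exact: (Ykv_over nK pv yv yb) | exact: (Ykv_over nK pw yw yb)].
Qed.

Lemma Ykv_exists K y : is_number_field K -> is_place Qbar y ->
  exists v, is_place K v /\ Ykv v y.
Proof.
move=> /subfield_nf sK py.
have [//|v [pv yv]] := exists_restriction sK subfield_Qbar _ py.
exists v; split => //; split => //.
by have [b yb] := place_neq0 py; exists b; split=> //; apply: yv.
Qed.

(** The conclusion of [compactY] for one fixed cover [F], isolated so that its failure can be passed
    from a ball to one of finitely many smaller balls. *)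
Definition fincover (F : set (set Yt)) (A : set Yt) :=
  exists G, [/\ G `<=` F, finite_set G & A `<=` \bigcup_(U in G) U].

Lemma fincover_bigcup (F : set (set Yt)) (I : choiceType) (D : set I)
    (A : I -> set Yt) :
  finite_set D -> (forall i, D i -> fincover F (A i)) ->
  fincover F (\bigcup_(i in D) A i).
Proof.
move=> fD h.
have [G hG] : exists G : I -> set (set Yt), forall i, D i ->
    [/\ G i `<=` F, finite_set (G i) & A i `<=` \bigcup_(U in G i) U].
  have /choice[G hG] : forall i, exists Gi, D i ->
      [/\ Gi `<=` F, finite_set Gi & A i `<=` \bigcup_(U in Gi) U].
    move=> i; have [/h[Gi hi]|nD] := pselect (D i); first by exists Gi.
    by exists set0.
  by exists G.
exists (\bigcup_(i in D) G i); split.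
- by move=> U [i Di]; have [h1 _ _] := hG i Di; apply: h1.
- by apply: bigcup_finite => // i Di; have [] := hG i Di.
- move=> y [i Di yi]; have [_ _ /(_ y yi)[U GU yU]] := hG i Di.
  by exists U => //; exists i.
Qed.

Lemma measurable_Ykv K v : is_number_field K -> is_place K v ->
  measurable (Ykv v : set Ymeas).
Proof. by move=> nK pv; apply: sub_sigma_algebra; exists K, v. Qed.

(** * Consequences of the measure: extension, finiteness, compactness *)

Section Measure.
Variable lam : {measure set Ymeas -> \bar RR}.
Hypothesis hlam : forall K v, is_number_field K -> is_place K v ->
  lam (Ykv v : set Ymeas) = (lamKv K v)%:E.

Lemma Ykv_neq0 K v : is_number_field K -> is_place K v -> exists y, Ykv v y.
Proof.
move=> nK pv; apply: contrapT => h.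
have e : Ykv v = set0 by apply/seteqP; split=> // y yv; apply: h; exists y.
have := hlam nK pv; rewrite e measure0 => -[l0].
by have := lamKv_gt0 nK pv; rewrite -l0 ltxx.
Qed.

(* The sets Ykv w are disjoint, of measure at least 1 / [L : Q], and lie in
   Ykv v, whose measure is finite. *)
Lemma finite_above K L v : is_number_field K -> is_number_field L ->
  K `<=` L -> is_place K v -> finite_set [set w | is_place L w /\ w `<=` v].
Proof.
move=> nK nL KL pv; apply: contrapT => inf.
have [N hN] := nat_unbounded (lamKv K v * (degree L)%:R).
have dp : 0 < (degree L)%:R :> RR by rewrite ltr0n degree_gt0.
have [B BA szB] := infinite_set_fset N inf.
pose D : set (set absv) := [set` B].
have mD w : D w -> measurable (Ykv w : set Ymeas).
  by move=> /BA[pw _]; apply: measurable_Ykv nL pw.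
have := @measure_fin_bigcup _ _ _ lam _ D (fun w => Ykv w : set Ymeas)
  (finite_fset B) _ mD.
have tD : trivIset D (fun w => Ykv w : set Ymeas).
  move=> w w' /BA[pw _] /BA[pw' _] [y [yw yw']]; exact: (Ykv_inj nL pw pw' yw yw').
move=> /(_ tD) mE.
have le1 : (lam (\bigcup_(w in D) (Ykv w : set Ymeas)) <= (lamKv K v)%:E)%E.
  rewrite -(hlam nK pv); apply: le_measure.
  - by rewrite inE; apply: fin_bigcup_measurable => //; apply: finite_fset.
  - by rewrite inE; apply: measurable_Ykv nK pv.
  - by move=> y [w /BA[_ wv]]; apply: Ykv_sub.
move: le1; rewrite mE.
rewrite (@eq_fsbigr _ _ _ _ _ (fun w => (lamKv L w)%:E)); last first.
  by move=> w; rewrite inE => /BA[pw _]; apply: hlam.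
rewrite -fsbig_seq ?finmap.fset_uniq // sumEFin lee_fin leNgt => /negP; apply.
apply: (@lt_le_trans _ _ (N%:R / (degree L)%:R)); first by rewrite ltr_pdivlMr.
apply: (@le_trans _ _ (\sum_(w <- B) (degree L)%:R^-1)).
  rewrite big_const_seq count_predT iter_addr addr0 -[X in _ <= X]mulr_natl.
  by rewrite ler_pM2r ?invr_gt0 // ler_nat.
rewrite big_seq [X in _ <= X]big_seq; apply: ler_sum => w wB.
by apply: lamKv_lb => //; have [] := BA w wB.
Qed.

(** A place of [Qbar] over [w] supplies [b] with b = a^t on [K]. Its power 1/t equals [a] there, and
    since [a] is at most n on each natural number n, [absval_pow] accepts this power. *)
Lemma normalized_absval K L v w a : is_number_field K -> is_number_field L ->
  K `<=` L -> is_place K v -> is_place L w -> w `<=` v -> v a ->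
  exists c, [/\ is_absval Qbar c, w c & forall x, K x -> c x = a x].
Proof.
move=> nK nL KL pv pw wv va; have [y yw] := Ykv_neq0 nL pw.
have sK := subfield_nf nK; have sL := subfield_nf nL.
have aK := place_mem pv va.
have py : is_place Qbar y by case: yw.
have [b yb] := place_neq0 py.
have wb : w b by apply: (Ykv_over nL pw yw yb).
have bQ := place_mem py yb.
have [t [t0 bt]] := place_equiv pv va (wv _ wb).
have bta x : K x -> b x `^ t^-1 = a x.
  by move=> Kx; rewrite bt // powRK ?gt_eqF // (absval_ge0 aK).
have cQ : is_absval Qbar (fun x => b x `^ t^-1).
  apply: absval_pow => //; rewrite ?invr_gt0 // => n.
  by rewrite bta; [exact: (absval_nat sK aK) | exact: subfield_nat].
exists (fun x => b x `^ t^-1); split => //; apply: (place_closed pw wb).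
  by apply: absval_sub cQ.
by exists t^-1; rewrite invr_gt0.
Qed.

Lemma normalized_unique K L v w a c c' : is_place K v ->
  K `<=` L -> is_place L w -> v a -> w c -> w c' ->
  (forall x, K x -> c x = a x) -> (forall x, K x -> c' x = a x) ->
  forall x, L x -> c x = c' x.
Proof.
move=> pv KL pw va wc wc' ca c'a x Lx.
have aK := place_mem pv va; have cL := place_mem pw wc.
have [s [s0 cs]] := place_equiv pw wc wc'.
(* A point of [K] where [a] is neither 0 nor 1 detects the exponent. *)
case: (aK) => _ _ _ _ [z [Kz z0 az]].
have s1 : s = 1.
  apply: (powR_eq_self (absval_gt0 aK Kz z0) az).
  by rewrite -[in LHS](ca _ Kz) -cs ?c'a //; apply: KL.
by rewrite cs // s1 powRr1 // (absval_ge0 cL).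
Qed.

Section Compactness.
Variables (K : set algC) (v : set absv) (a : absv).
Hypotheses (nK : is_number_field K) (pv : is_place K v) (va : v a).

(** Normalised representatives of two layers agree on the smaller one, and the tower exhausts
    [algC]. The algebraic axioms of an absolute value involve at most two elements, which lie in a
    common layer, so the glued function inherits them; it is nontrivial because it equals [a] on
    [K]. *)
Lemma limit_place (Ks : nat -> set algC) (ws : nat -> set absv) :
  (forall n, [/\ is_number_field (Ks n), is_place (Ks n) (ws n),
     K `<=` Ks n & ws n `<=` v]) ->
  (forall n, Ks n `<=` Ks n.+1) -> (forall n, ws n.+1 `<=` ws n) ->
  (forall x, exists n, Ks n x) ->
  exists y, forall n, Ykv (ws n) y.
Proof.
move=> h KS wS Kall.
have Kmono m n : (m <= n)%N -> Ks m `<=` Ks n.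
  elim: n => [|n IH]; first by rewrite leqn0 => /eqP->.
  by rewrite leq_eqVlt => /predU1P[->//|/IH mn]; apply: subset_trans mn (KS n).
have wmono m n : (m <= n)%N -> ws n `<=` ws m.
  elim: n => [|n IH]; first by rewrite leqn0 => /eqP->.
  by rewrite leq_eqVlt => /predU1P[->//|/IH mn]; apply: subset_trans (wS n) mn.
have /choice[cs hcs] : forall n, exists c,
    [/\ is_absval Qbar c, ws n c & forall x, K x -> c x = a x].
  by move=> n; have [nL pw KL wv] := h n; apply: (normalized_absval nK nL KL pv pw wv va).
have csE m n x : (m <= n)%N -> Ks m x -> cs m x = cs n x.
  move=> mn; have [_ pw KL wv] := h m; have [_ wc ca] := hcs m.
  have [_ /(wmono _ _ mn) wc' ca'] := hcs n.
  exact: (normalized_unique pv KL pw va wc wc' ca ca').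
have /choice[N hN] := Kall.
pose c x := cs (N x) x.
have cE m x : Ks m x -> c x = cs m x.
  move=> Kx; rewrite /c (csE _ (maxn (N x) m)) ?leq_maxl //.
  by rewrite -(csE m) // leq_maxr.
have cQ : is_absval Qbar c.
  have two x y : exists m, [/\ Ks m x, Ks m y & is_subfield (Ks m)].
    exists (maxn (N x) (N y)); split.
    - by apply: (Kmono (N x)) => //; apply: leq_maxl.
    - by apply: (Kmono (N y)) => //; apply: leq_maxr.
    - by apply: subfield_nf; case: (h (maxn (N x) (N y))).
  split.
  - by move=> x _; have [cN _ _] := hcs (N x); apply: (absval_ge0 cN).
  - by move=> x _; have [[_ cN _ _ _] _ _] := hcs (N x); apply: cN.
  - move=> x y _ _; have [m [mx my sm]] := two x y.
    have [cm _ _] := hcs m; rewrite !(cE m) ?(absvalM cm) //.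
    by case: sm => _ _ _ mM _; apply: mM.
  - move=> x y _ _; have [m [mx my sm]] := two x y.
    have [cm _ _] := hcs m; rewrite !(cE m) ?(absvalD cm) //.
    exact: subfieldD.
  - case: (place_mem pv va) => _ _ _ _ [z [Kz z0 az]].
    exists z; split => //; have [_ _ K0 _] := h 0%N.
    by rewrite (cE 0%N z (K0 _ Kz)); have [_ _ ->] := hcs 0%N.
exists (place_of Qbar c) => n; split; first exact: is_place_of.
exists c; split; first exact: place_of_self.
have [nn pn _ _] := h n; have [_ wc _] := hcs n.
apply: (place_closed pn wc); first exact: (absval_sub (subfield_nf nn) _ _ cQ).
exists 1; split => // x Kx; rewrite powRr1 ?(cE n) //.
by apply: (absval_ge0 (place_mem pn wc)).
Qed.

Lemma compact_Ykv : compactY (Ykv v).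
Proof.
move=> F Fo Fc; apply: contrapT => nofin.
pose bad (p : set algC * set absv) := [/\ is_number_field p.1,
  is_place p.1 p.2, K `<=` p.1, p.2 `<=` v & ~ fincover F (Ykv p.2)].
(* One step of Konig's lemma. Finitely many balls over a larger field [M] cover the current one, so
   one of them is again not finitely covered. [M] is chosen to contain the algebraic number with
   code n, if there is one, so that the tower exhausts [algC]. *)
have step (nst : nat * {p | bad p}) : exists st' : {p | bad p},
    [/\ (sval nst.2).1 `<=` (sval st').1, (sval st').2 `<=` (sval nst.2).2 &
      forall x : algC, choice.pickle x = nst.1 -> (sval st').1 x].
  case: nst => n [[L w] /= [nL pw KL wv nc]].
  pose s : seq algC := if choice.pickle_inv n is Some x then [:: x] else [::].
  have [M [nM LM _ sM]] := compositum s nL nL.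
  have [w' [pw' w'w nc']] : exists w', [/\ is_place M w', w' `<=` w & ~ fincover F (Ykv w')].
    apply: contrapT => nw; apply: nc.
    have := @fincover_bigcup F _ _ (fun w' => Ykv w') (finite_above nL nM LM pw).
    case=> [w' [pw' w'w]|G [GF fG cG]].
      by apply: contrapT => nc'; apply: nw; exists w'.
    exists G; split => // y yw; apply: cG.
    have [w' [pw' yw']] : exists w', is_place M w' /\ Ykv w' y.
      by apply: Ykv_exists => //; case: yw.
    exists w' => //; split => //; exact: (Ykv_meet nL nM LM pw pw' yw yw').
  have bM : bad (M, w').
    by split => //=; [exact: subset_trans KL LM | exact: subset_trans w'w wv].
  exists (exist _ _ bM); split => //= x xn.
  have : x \in M by apply: sM; rewrite /s -xn choice.pickleK_inv mem_head.
  by rewrite inE.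
have b0 : bad (K, v) by split.
have [nxt hnxt] := choice step.
pose st := fix st n := if n is m.+1 then nxt (m, st m) else exist _ _ b0.
pose Ks n := (sval (st n)).1; pose ws n := (sval (st n)).2.
have [y hy] : exists y, forall n, Ykv (ws n) y.
  apply: (@limit_place Ks ws).
  - by move=> n; rewrite /Ks /ws; case: (st n) => p [].
  - by move=> n; have [] := hnxt (n, st n).
  - by move=> n; have [] := hnxt (n, st n).
  - by move=> x; exists (choice.pickle x).+1; have [_ _] := hnxt (choice.pickle x, st (choice.pickle x)); apply.
have [U FU Uy] := Fc y (hy 0%N).
have [B [[L [w [nL pw BE]]] By BU]] := Fo U FU y Uy.
have Kmono m n : (m <= n)%N -> Ks m `<=` Ks n.
  elim: n => [|n IH]; first by rewrite leqn0 => /eqP->.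
  rewrite leq_eqVlt => /predU1P[->//|/IH mn]; apply: subset_trans mn _.
  by have [] := hnxt (n, st n).
(* [L] is spanned by finitely many numbers, so it lies in a layer of the tower; the ball of that
   layer through [y] then lies in the single set [U], against its badness. *)
have [m Lm] : exists m, L `<=` Ks m.
  have [s [_ ->]] := number_field_span nL.
  have [m hm] : exists m, {subset s <= Ks m}.
    elim: s => [|x s [m hm]]; first by exists 0%N.
    exists (maxn m (choice.pickle x).+1) => z; rewrite !inE => /orP[/eqP->|zs].
      apply: (Kmono (choice.pickle x).+1); first exact: leq_maxr.
      by have [_ _] := hnxt (choice.pickle x, st (choice.pickle x)); apply.
    by apply: (Kmono m); [exact: leq_maxl | have := hm z zs; rewrite inE].
  exists m; apply: Qspan_sub hm; apply: subfield_nf.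
  by rewrite /Ks; case: (st m) => p [].
have [nM pm _ _ nc] : bad (sval (st m)) by case: (st m).
apply: nc; exists [set U]; split.
- by move=> ? ->.
- exact: finite_set1.
- move=> z zm; exists U => //; apply: BU; rewrite BE.
  by apply: Ykv_sub zm; rewrite BE in By; apply: (Ykv_meet nL nM Lm pw pm By (hy m)).
Qed.

End Compactness.

End Measure.

(** * Functions in LC_c(X) described over one number field *)

Section Functions.
Variables (S : set (set absv)) (lam : {measure set Ymeas -> \bar RR}).
Hypothesis hS : forall u, S u -> is_place Qfield u.
Hypothesis hlam : forall K v, is_number_field K -> is_place K v ->
  lam (Ykv v : set Ymeas) = (lamKv K v)%:E.

Lemma inJ_nf K v : inJ S K v -> is_number_field K. Proof. by case. Qed.
Lemma inJ_place K v : inJ S K v -> is_place K v. Proof. by case. Qed.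

Lemma inJ_sub K v : inJ S K v -> exists2 u, S u & v `<=` u.
Proof.
case=> nK pv [u [Su [b [vb ub]]]]; exists u => //.
have sK := subfield_nf nK.
exact: (lies_over_sub subfield_Qfield sK (Qfield_sub sK) (hS Su) pv vb ub).
Qed.

Lemma inJ_Xs K v y : inJ S K v -> Ykv v y -> Xs S y.
Proof.
move=> Jv [py [b [yb vb]]]; split => //.
by have [u Su vu] := inJ_sub Jv; exists u; split=> //; exists b; split=> //; apply: vu.
Qed.

Lemma Xs_inJ K v y : Xs S y -> is_number_field K -> is_place K v ->
  Ykv v y -> inJ S K v.
Proof.
move=> [py [u [Su [b [yb ub]]]]] nK pv yv; split => //; exists u; split => //.
by exists b; split => //; apply: (Ykv_over nK pv yv).
Qed.

Lemma Xs_place K y : is_number_field K -> Xs S y ->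
  exists2 v, inJ S K v & Ykv v y.
Proof.
move=> nK Xy; have [|v [pv yv]] := Ykv_exists (y := y) nK; first by case: Xy.
by exists v => //; apply: Xs_inJ Xy nK pv yv.
Qed.

Lemma inJ_Ykv K v : inJ S K v -> exists2 y, Ykv v y & Xs S y.
Proof.
move=> Jv; have [y yv] := Ykv_neq0 hlam (inJ_nf Jv) (inJ_place Jv).
by exists y => //; apply: inJ_Xs Jv yv.
Qed.

Lemma fval_eq K f v y : adapted S K f -> inJ S K v -> Ykv v y ->
  fval S f v = f y.
Proof.
move=> [_ fc _] Jv yv; rewrite /fval; set D := (X in xget _ X).
have [|z [zv [Xz <-]]] := @xgetPex _ 0 D.
  by exists (f y), y; split => //; split => //; apply: inJ_Xs Jv yv.
by apply: (fc v) => //; apply: inJ_Xs Jv yv.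
Qed.

Lemma inJ_below K L w : is_number_field K -> K `<=` L -> inJ S L w ->
  exists2 v, inJ S K v & w `<=` v.
Proof.
move=> nK KL Jw; have [y yw Xy] := inJ_Ykv Jw.
have [v Jv yv] := Xs_place nK Xy; exists v => //.
exact: (Ykv_meet nK (inJ_nf Jw) KL (inJ_place Jv) (inJ_place Jw) yv yw).
Qed.

Lemma fval_above K L f v w : adapted S K f -> inJ S K v -> inJ S L w ->
  w `<=` v -> fval S f w = fval S f v.
Proof.
move=> fK Jv Jw wv; have [y yw Xy] := inJ_Ykv Jw.
have yv := Ykv_sub wv yw; rewrite (fval_eq fK Jv yv).
rewrite /fval; set D := (X in xget _ X).
have [|z [zw [Xz <-]]] := @xgetPex _ 0 D; first by exists (f y), y.
case: fK => _ fc _; apply: (fc v) => //; exact: Ykv_sub zw.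
Qed.

(** Finiteness of the support survives because [finite_above] puts only finitely many places of [L]
    over each place of [K] in it. *)
Lemma adapted_extend K L f : adapted S K f -> is_number_field L -> K `<=` L ->
  adapted S L f.
Proof.
move=> fK nL KL; case: (fK) => nK fc ff; split => //.
  move=> w Jw y z yw zw Xy Xz; have [v Jv wv] := inJ_below nK KL Jw.
  by apply: (fc v) => //; apply: Ykv_sub wv _ _.
pose A := [set v | inJ S K v /\ fval S f v != 0].
apply: (@sub_finite_set _ _
  (\bigcup_(v in A) [set w | is_place L w /\ w `<=` v])).
  move=> w /= [Jw fw]; have [v Jv wv] := inJ_below nK KL Jw.
  exists v; last by split => //; apply: inJ_place Jw.
  by split => //; rewrite -(fval_above fK Jv Jw wv).
apply: bigcup_finite => // v [Jv _].
exact: (finite_above hlam nK nL KL (inJ_place Jv)).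
Qed.

Lemma adapted_common K K' f g : adapted S K f -> adapted S K' g ->
  exists L, adapted S L f /\ adapted S L g.
Proof.
move=> fK gK; have [nK _ _] := fK; have [nK' _ _] := gK.
have [L [nL KL KL' _]] := compositum [::] nK nK'.
by exists L; split; [exact: adapted_extend KL | exact: adapted_extend KL'].
Qed.

Lemma adapted_lin K f g (a b : RR) : adapted S K f -> adapted S K g ->
  adapted S K (fun y => a * f y + b * g y) /\
  (forall v, inJ S K v ->
    fval S (fun y => a * f y + b * g y) v = a * fval S f v + b * fval S g v).
Proof.
move=> fK gK; case: (fK) => nK fc ff; case: (gK) => _ gc gf.
set h := fun y => _.
have hc v : inJ S K v -> forall y z, Ykv v y -> Ykv v z -> Xs S y -> Xs S z ->
    h y = h z.
  by move=> Jv y z yv zv Xy Xz; rewrite /h (fc v Jv y z) // (gc v Jv y z).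
have hval v : inJ S K v -> fval S h v = a * fval S f v + b * fval S g v.
  move=> Jv; have [y yv Xy] := inJ_Ykv Jv.
  rewrite (fval_eq fK Jv yv) (fval_eq gK Jv yv) /fval; set D := (X in xget _ X).
  have [|z [zv [Xz <-]]] := @xgetPex _ 0 D; first by exists (h y), y.
  exact: (hc v).
split => //; split => //.
apply: (@sub_finite_set _ _ ([set v | inJ S K v /\ fval S f v != 0] `|`
   [set v | inJ S K v /\ fval S g v != 0])); last by rewrite finite_setU.
move=> v /= [Jv]; rewrite hval // => hv.
have [f0|fn0] := eqVneq (fval S f v) 0; last by left.
right; split => //; apply: contra_neq hv => g0.
by rewrite f0 g0 !mulr0 addr0.
Qed.

(** The list may exceed the support, so that two functions and their linear combinations can share
    it. *)
Definition supports (K : set algC) (f : Yt -> RR) (r : seq (set absv)) :=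
  [/\ uniq r, forall v, v \in r -> inJ S K v &
      forall v, inJ S K v -> fval S f v != 0 -> v \in r].

Lemma exists_supports2 K f g : adapted S K f -> adapted S K g ->
  exists r, supports K f r /\ supports K g r.
Proof.
move=> [_ _ ff] [_ _ gf].
pose A := [set v | inJ S K v /\ fval S f v != 0] `|`
   [set v | inJ S K v /\ fval S g v != 0].
have fA : finite_set A by rewrite finite_setU.
have rA v : v \in enum_fset (fset_set A) = (v \in A) by rewrite in_fset_set.
exists (enum_fset (fset_set A)); split; split; rewrite ?fset_uniq // => v.
- by rewrite rA inE => -[[]|[]].
- by move=> Jv fv; rewrite rA inE; left.
- by rewrite rA inE => -[[]|[]].
- by move=> Jv fv; rewrite rA inE; right.
Qed.

Lemma fsum_supports K f r c : supports K f r ->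
  \sum_(v \in [set v | inJ S K v]) c K v * fval S f v =
  \sum_(v <- r) c K v * fval S f v :> RR.
Proof.
move=> [ur rJ rs]; rewrite [RHS]fsbig_seq //; symmetry; apply: fsbig_widen.
  by move=> v /rJ.
move=> v [/= Jv nr]; rewrite /preimage /=.
have [->|fv] := eqVneq (fval S f v) 0; first by rewrite mulr0.
by case: nr; apply: rs.
Qed.

(** Independence of the field in [Phi]: consistency splits each coefficient over the places above,
    [f] keeps its value there, and each place of [L] lies over exactly one place of [K]. *)
Lemma fsum_extend K L f c : consistent S c -> adapted S K f ->
  is_number_field L -> K `<=` L ->
  \sum_(v \in [set v | inJ S K v]) c K v * fval S f v =
  \sum_(w \in [set w | inJ S L w]) c L w * fval S f w :> RR.
Proof.
move=> cc fK nL KL; have fL := adapted_extend fK nL KL.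
have nK : is_number_field K by case: fK.
have [rK [sK _]] := exists_supports2 fK fK.
have [rL [sL _]] := exists_supports2 fL fL.
rewrite (fsum_supports c sK) (fsum_supports c sL).
case: sK => uK KJ Ks; case: sL => uL LJ Ls.
(* Where f(v) = 0 the list [rL] may miss places above v; keeping only nonzero values makes the inner
   sum run over all the places above v. *)
pose fwn0 v := fval S f v != 0.
transitivity (\sum_(v <- rK | fwn0 v)
    \sum_(w <- rL | `[< w `<=` v >]) c L w * fval S f w).
  rewrite [RHS]big_mkcond /= big_seq [RHS]big_seq; apply: eq_bigr => v vr.
  have Jv := KJ v vr; rewrite /fwn0; case: eqVneq => [->|fv]; first by rewrite mulr0.
  rewrite (cc K v L) //.
  set A := [set w | _].
  have AE : A = [set w | inJ S L w /\ w `<=` v].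
    have o w : is_place L w -> lies_over w v <-> w `<=` v.
      by move=> pw; apply: (lies_overE (subfield_nf nK) (subfield_nf nL) KL
        (inJ_place Jv) pw).
    apply/seteqP; split => w [Jw wv]; split => //; apply/o => //;
      exact: inJ_place Jw.
  have fA : finite_set A.
    apply: sub_finite_set (finite_above hlam nK nL KL (inJ_place Jv)).
    by rewrite AE => w [Jw wv]; split => //; apply: inJ_place Jw.
  rewrite (fsbig_finite _ _ fA) /= mulr_suml -[RHS]big_filter.
  rewrite [LHS](perm_big [seq w <- rL | `[< w `<=` v >]]); last first.
    apply: uniq_perm; rewrite ?fset_uniq ?filter_uniq // => w.
    rewrite in_fset_set // AE mem_filter; apply/idP/idP.
      rewrite inE => -[Jw wv]; apply/andP; split; first exact/asboolP.
      by apply: Ls => //; rewrite (fval_above fK Jv Jw wv).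
    by move=> /andP[/asboolP wv wr]; rewrite inE; split => //; apply: LJ.
  rewrite !big_filter big_seq_cond [RHS]big_seq_cond; apply: eq_bigr => w.
  by move=> /andP[wr /asboolP wv]; rewrite (fval_above fK Jv (LJ _ wr) wv).
(* After the exchange, for [w] with nonzero value the inner sum has a single term, given by the
   place of [K] below [w]. *)
rewrite (exchange_big_dep predT) //= big_seq [RHS]big_seq.
apply: eq_bigr => w wr; have Jw := LJ w wr.
have [v Jv wv] := inJ_below nK KL Jw.
have [fw|fw] := eqVneq (fval S f w) 0.
  by rewrite fw mulr0 big1.
have vK : v \in rK by apply: Ks => //; rewrite -(fval_above fK Jv Jw wv).
rewrite -big_filter (perm_big [:: v]) ?big_seq1 //.
apply: uniq_perm; rewrite ?filter_uniq // => v'; rewrite mem_filter inE.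
apply/idP/eqP => [/andP[/andP[_ /asboolP wv'] /KJ Jv']|->].
  have [b wb] := place_neq0 (inJ_place Jw).
  exact: (place_inter (inJ_place Jv') (inJ_place Jv) (wv' _ wb) (wv _ wb)).
by rewrite vK andbT /fwn0 -(fval_above fK Jv Jw wv) fw; apply/asboolP.
Qed.

Lemma Phi_supports K f r c : consistent S c -> adapted S K f ->
  supports K f r -> Phi S c f = \sum_(v <- r) c K v * fval S f v.
Proof.
move=> cc fK fr; rewrite -(fsum_supports c fr) /Phi.
have [|K' [fK' ->]] := @xgetPex _ 0 (PhiVal S c f).
  by exists (\sum_(v \in [set v | inJ S K v]) c K v * fval S f v), K.
have [nK _ _] := fK; have [nK' _ _] := fK'.
have [L [nL KL KL' _]] := compositum [::] nK nK'.
by rewrite (fsum_extend cc fK nL KL) (fsum_extend cc fK' nL KL').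
Qed.

Lemma finite_basic (G : set (set Yt)) : finite_set G -> G `<=` basic ->
  exists2 K, is_number_field K & forall U, G U -> exists K' v,
    [/\ is_number_field K', is_place K' v, K' `<=` K & U = Ykv v].
Proof.
move=> /finite_seqP[s ->]; elim: s => [|U s IH] sb.
  by have [K [nK _]] := number_field_of_seq [::]; exists K.
have [|K nK hK] := IH; first by move=> V sV; apply: sb; rewrite /= inE sV orbT.
have [K1 [v [nK1 pv UE]]] : basic U by apply: sb; rewrite /= mem_head.
have [L [nL KL KL1 _]] := compositum [::] nK nK1.
exists L => // V /=; rewrite inE => /predU1P[->|sV]; first by exists K1, v.
have [K' [v' [nK' pv' K'K VE]]] := hK V sV.
by exists K', v'; split => //; apply: subset_trans KL.
Qed.

(** Compactness of the support gives finitely many basic sets on which [f] is constant. Over a field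
    [K] containing all the fields involved, a ball that meets one of these sets lies inside it. *)
Lemma exists_adapted f : inL S f -> exists K, adapted S K f.
Proof.
move=> [f0 floc fcomp].
pose F := [set U | basic U /\ exists2 x, U x &
  forall y, Xs S y -> U y -> f y = f x].
have [||G [GF fG cG]] := fcomp F.
- by move=> U [bU _] y Uy; exists U; split.
- move=> x [Xx _]; have [U [bU Ux Uf]] := floc x Xx.
  by exists U => //; split => //; exists x.
have [|K nK hK] := finite_basic fG; first by move=> U /GF[].
have inG y : Xs S y -> f y != 0 -> exists2 U, G U & U y.
  move=> Xy fy; have [|U GU Uy] := cG y; last by exists U.
  by split => // B bB By; exists y.
have GY v U y : inJ S K v -> G U -> U y -> Ykv v y -> Ykv v `<=` U.
  move=> Jv GU; have [K' [v' [nK' pv' K'K ->]]] := hK U GU => yv' yv.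
  exact/Ykv_sub/(Ykv_meet nK' nK K'K pv' (inJ_place Jv) yv' yv).
have fc v : inJ S K v -> forall y z, Ykv v y -> Ykv v z -> Xs S y -> Xs S z ->
    f y = f z.
  move=> Jv y z yv zv Xy Xz.
  have [[U GU UY]|nU] := pselect (exists2 U, G U & Ykv v `<=` U).
    have [_ [x _ hx]] := GF U GU.
    by rewrite (hx y Xy (UY _ yv)) (hx z Xz (UY _ zv)).
  (* A ball inside no member of [G] meets none of them, and [f] vanishes on X outside the cover. *)
  have z0 t : Ykv v t -> Xs S t -> f t = 0.
    move=> tv Xt; apply: contrapT => /eqP ft; apply: nU.
    by have [U GU Ut] := inG t Xt ft; exists U => //; apply: GY Jv GU Ut tv.
  by rewrite !z0.
exists K; split => //.
apply: (@sub_finite_set _ _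
  (\bigcup_(U in G) [set v | is_place K v /\ Ykv v `<=` U])).
  move=> v [Jv]; rewrite /fval; case: xgetP => [r _ [y [yv [Xy fy]]] r0|_]; last by rewrite eqxx.
  have [|U GU Uy] := inG y Xy; first by rewrite fy.
  by exists U => //; split; [exact: inJ_place Jv | exact: GY Jv GU Uy yv].
apply: bigcup_finite => // U GU; have [K' [v' [nK' pv' K'K ->]]] := hK U GU.
apply: sub_finite_set (finite_above hlam nK' nK K'K pv') => v [pv vv'].
split => //; have [y yv] := Ykv_neq0 hlam nK pv.
exact: (Ykv_meet nK' nK K'K pv' pv (vv' _ yv) yv).
Qed.

(** The balls over [K] of places in J partition X, so the support is a finite union of them, already
    closed in X, and each ball is compact. *)
Lemma adapted_inL K f : adapted S K f -> (forall y, ~ Xs S y -> f y = 0) ->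
  inL S f.
Proof.
move=> fK f0; case: (fK) => nK fc ff; split => //.
  move=> x Xx; have [v Jv xv] := Xs_place nK Xx.
  exists (Ykv v); split => //.
    by exists K, v; split => //; apply: inJ_place Jv.
  by move=> y Xy yv; apply: (fc v).
move=> F Fo Fc.
suff [G [GF fG cG]] : fincover F
    (\bigcup_(v in [set v | inJ S K v /\ fval S f v != 0]) Ykv v).
  exists G; split => // x [Xx cx]; apply: cG.
  have [v Jv xv] := Xs_place nK Xx; exists v => //; split => //.
  have [||y [Xy yv fy]] := cx (Ykv v) => //.
    by exists K, v; split => //; apply: inJ_place Jv.
  by rewrite (fval_eq fK Jv yv); case: fy.
apply: fincover_bigcup => // v [Jv fv].
have [a va] := place_neq0 (inJ_place Jv).
apply: (compact_Ykv hlam nK (inJ_place Jv) va Fo).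
move=> x xv; have Xx := inJ_Xs Jv xv.
apply: Fc; split => // B bB Bx; exists x; split => //; split => //.
by rewrite -(fval_eq fK Jv xv).
Qed.

Lemma inL_off f y : inL S f -> ~ Xs S y -> f y = 0.
Proof. by case=> h _ _; apply: h. Qed.

Lemma indic_adapted K v : inJ S K v -> adapted S K (\1_(Ykv v) : Yt -> RR) /\
  (forall w, inJ S K w -> fval S (\1_(Ykv v) : Yt -> RR) w = (w == v)%:R).
Proof.
move=> Jv; have nK := inJ_nf Jv; set f : Yt -> RR := \1_(Ykv v).
have fE w y : inJ S K w -> Ykv w y -> f y = (w == v)%:R.
  move=> Jw yw; rewrite /f indicE; congr (_%:R); congr nat_of_bool.
  apply/idP/eqP => [|wv]; last by rewrite inE -wv.
  by rewrite inE; apply: (Ykv_inj nK (inJ_place Jw) (inJ_place Jv) yw).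
have fv w : inJ S K w -> fval S f w = (w == v)%:R.
  move=> Jw; have [y yw Xy] := inJ_Ykv Jw; rewrite /fval; set D := (X in xget _ X).
  have [|z [zw [Xz <-]]] := @xgetPex _ 0 D; first by exists (f y), y.
  exact: fE.
split => //; split => //.
  by move=> w Jw y z yw zw _ _; rewrite !(fE w).
apply: (@sub_finite_set _ _ [set v]) => // w [Jw].
by rewrite fv //; case: (eqVneq w v) => [->|_ /eqP].
Qed.

Lemma indic_inL K v : inJ S K v -> inL S (\1_(Ykv v) : Yt -> RR).
Proof.
move=> Jv; apply: adapted_inL (indic_adapted Jv).1 _ => y nX.
rewrite indicE memNset // => yv; apply: nX; exact: inJ_Xs Jv yv.
Qed.

Lemma decomposition K f r : adapted S K f -> (forall y, ~ Xs S y -> f y = 0) ->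
  supports K f r -> f = fun y => \sum_(v <- r) fval S f v * \1_(Ykv v) y.
Proof.
move=> fK f0 [ur rJ rs]; apply/funext => y; have nK : is_number_field K by case: fK.
have [Xy|nX] := pselect (Xs S y); last first.
  rewrite f0 // big_seq big1 // => v vr; rewrite indicE memNset ?mulr0 //.
  by move=> yv; apply: nX; apply: inJ_Xs (rJ v vr) yv.
have [v Jv yv] := Xs_place nK Xy; rewrite -(fval_eq fK Jv yv).
have other w : w \in r -> w != v -> \1_(Ykv w) y = 0 :> RR.
  move=> wr wv; rewrite indicE memNset // => yw; move/eqP: wv; apply.
  exact: (Ykv_inj nK (inJ_place (rJ w wr)) (inJ_place Jv) yw yv).
have [vr|nr] := boolP (v \in r).
  rewrite (bigD1_seq v) //= indicE mem_set // mulr1 big_seq_cond big1 ?addr0 //.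
  by move=> w /andP[wr wv]; rewrite other // mulr0.
have -> : fval S f v = 0 by apply: contraNeq nr => /(rs v Jv).
rewrite big_seq big1 // => w wr; rewrite other ?mulr0 //.
by apply: contraNneq nr => <-.
Qed.

(** At most one ball of the list contains a given point, so absolute values commute with the sum of
    step functions, which is then integrated term by term. *)
Lemma normL_supports K f r : adapted S K f -> (forall y, ~ Xs S y -> f y = 0) ->
  supports K f r -> normL S lam f = \sum_(v <- r) `|fval S f v| * lamKv K v.
Proof.
move=> fK f0 fr; have nK : is_number_field K by case: fK.
(* The set is made empty when the pair is not in J, because integrating a sum term by term asks for
   measurability at every index, not only at those in [r]. *)
pose Z v : set Ymeas := [set y | inJ S K v /\ Ykv v y].
have ZE v : inJ S K v -> Z v = Ykv v by move=> Jv; apply/seteqP; split=> y // [].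
have mZ v : measurable (Z v).
  have [Jv|nJ] := pselect (inJ S K v).
    by rewrite ZE //; apply: measurable_Ykv nK (inJ_place Jv).
  have -> : Z v = set0 by apply/seteqP; split=> y // [].
  exact: measurable0.
have absE y : `|f y| = \sum_(v <- r) `|fval S f v| * \1_(Z v) y.
  rewrite [f in LHS](decomposition fK f0 fr); case: fr => ur rJ rs.
  rewrite [RHS](eq_big_seq (fun v => `|fval S f v| * \1_(Ykv v) y)); last first.
    by move=> v vr; rewrite ZE //; apply: rJ.
  have [[v vr yv]|no] := pselect (exists2 v, v \in r & Ykv v y).
    have other w : w \in r -> w != v -> \1_(Ykv w) y = 0 :> RR.
      move=> wr wv; rewrite indicE memNset // => yw; move/eqP: wv; apply.
      exact: (Ykv_inj nK (inJ_place (rJ w wr)) (inJ_place (rJ v vr)) yw yv).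
    have sumE (k : set absv -> RR) : \sum_(w <- r) k w * \1_(Ykv w) y = k v.
      rewrite (bigD1_seq v) //= indicE mem_set // mulr1 big_seq_cond big1 ?addr0 //.
      by move=> w /andP[wr wv]; rewrite other // mulr0.
    by rewrite (sumE (fval S f)) (sumE (fun v => `|fval S f v|)).
  have sumE (k : set absv -> RR) : \sum_(w <- r) k w * \1_(Ykv w) y = 0.
    rewrite big_seq big1 // => w wr; rewrite indicE memNset ?mulr0 // => yw.
    by apply: no; exists w.
  by rewrite (sumE (fval S f)) (sumE (fun v => `|fval S f v|)) normr0.
rewrite /normL integral_mkcond.
rewrite (_ : _ \_ _ = fun y : Ymeas =>
    (\sum_(v <- r) (`|fval S f v| * \1_(Z v) y)%:E)%E); last first.
  apply/funext => y; rewrite patchE sumEFin -absE; case: ifPn => // /negP nX.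
  by rewrite f0 ?normr0 // => Xy; apply: nX; rewrite inE.
rewrite ge0_integral_sum //=; last first.
  by move=> v; apply/measurable_EFinP; apply: measurable_funM.
rewrite (@eq_big_seq _ _ _ _ _ _ (fun v => (`|fval S f v| * lamKv K v)%:E)).
  by rewrite sumEFin.
move=> v vr; have Jv : inJ S K v by case: fr => _ /(_ v vr).
rewrite (@integralZl_indic _ _ _ _ _ _ (fun=> Z v)) //; last first.
  by rewrite ltNge normr_ge0.
by rewrite integral_indic // setIT ZE // (hlam nK (inJ_place Jv)).
Qed.

End Functions.

(** * Consistent maps and continuous linear functionals *)

Section Duality.
Variables (S : set (set absv)) (lam : {measure set Ymeas -> \bar RR}).
Hypothesis hS : forall u, S u -> is_place Qfield u.
Hypothesis hlam : forall K v, is_number_field K -> is_place K v ->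
  lam (Ykv v : set Ymeas) = (lamKv K v)%:E.

Lemma consistent_lin c d (a b : RR) : consistent S c -> consistent S d ->
  consistent S (fun K v => a * c K v + b * d K v).
Proof.
move=> cc cd K v L Jv nL KL.
rewrite (cc K v L) // (cd K v L) //.
set A := [set w | _].
(* A sum with infinite support defaults to 0, so additivity rests on the finiteness of the index
   set. *)
have fA : finite_set A.
  have nK := inJ_nf Jv; have pv := inJ_place Jv.
  apply: sub_finite_set (finite_above hlam nK nL KL pv) => w [Jw wv].
  have pw := inJ_place Jw; split => //.
  exact/(lies_overE (subfield_nf nK) (subfield_nf nL) KL pv pw).
rewrite !(fsbig_finite _ _ fA) /= !mulr_sumr.
by rewrite -big_split.
Qed.

Lemma supports_lin K f g r (a b : RR) : adapted S K f -> adapted S K g ->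
  supports S K f r -> supports S K g r ->
  supports S K (fun y => a * f y + b * g y) r.
Proof.
move=> fK gK [ur rJ rf] [_ _ rg]; split => // v Jv.
have [_ ->] := adapted_lin hS hlam a b fK gK; last by [].
have [f0|/(rf v Jv)//] := eqVneq (fval S f v) 0.
have [g0|/(rg v Jv)//] := eqVneq (fval S g v) 0.
by rewrite f0 g0 !mulr0 addr0 eqxx.
Qed.

Lemma Phi_linL c : consistent S c -> linL S (Phi S c).
Proof.
move=> cc f g a b fL gL.
have [K1 fK1] := exists_adapted hlam fL; have [K2 gK2] := exists_adapted hlam gL.
have [K [fK gK]] := adapted_common hS hlam fK1 gK2.
have [r [fr gr]] := exists_supports2 fK gK.
have [hK hv] := adapted_lin hS hlam a b fK gK.
rewrite (Phi_supports hS hlam cc hK (supports_lin a b fK gK fr gr)).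
rewrite (Phi_supports hS hlam cc fK fr) (Phi_supports hS hlam cc gK gr).
rewrite !mulr_sumr -big_split /= big_seq [RHS]big_seq; apply: eq_bigr => v vr.
rewrite hv; last by case: fr => _ rJ _; apply: rJ.
by rewrite mulrDr !(mulrCA (c K v)).
Qed.

(** Over a field adapted to both functions the norm has the weights [lamKv K v], so the bound on [c]
    applies term by term. *)
Lemma Phi_norm_le c (M : RR) f g : consistent S c -> 0 <= M ->
  (forall K v, inJ S K v -> `|c K v| <= M * lamKv K v) ->
  inL S f -> inL S g ->
  `|Phi S c g - Phi S c f| <= M * normL S lam (fun y => g y - f y).
Proof.
move=> cc M0 cM fL gL.
have [K1 fK1] := exists_adapted hlam fL; have [K2 gK2] := exists_adapted hlam gL.
have [K [fK gK]] := adapted_common hS hlam fK1 gK2.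
have [r [fr gr]] := exists_supports2 fK gK.
have [hK hv] := adapted_lin hS hlam 1 (-1) gK fK.
have hr := supports_lin 1 (-1) gK fK gr fr.
have -> : (fun y => g y - f y) = fun y => 1 * g y + (-1) * f y.
  by apply/funext => y; rewrite mul1r mulN1r.
rewrite (normL_supports hS hlam hK _ hr); last first.
  by move=> y nX; rewrite (inL_off fL nX) (inL_off gL nX) !mulr0 addr0.
rewrite (Phi_supports hS hlam cc fK fr) (Phi_supports hS hlam cc gK gr).
rewrite -sumrB mulr_sumr; apply: le_trans (ler_norm_sum _ _ _) _.
rewrite big_seq [X in _ <= X]big_seq; apply: ler_sum => v vr.
have Jv : inJ S K v by case: fr => _ rJ _; apply: rJ.
rewrite hv // mul1r mulN1r -mulrBr normrM mulrCA mulrC.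
by rewrite ler_wpM2l // cM.
Qed.

Lemma Phi_contL c : inJ' S c -> contL S lam (Phi S c).
Proof.
move=> [cc [M hM]] f fL e e0.
(* [M] may be 0, or even negative when J is empty; this replacement is a positive divisor in every
   case. *)
have M0 : 0 < `|M| + 1 by rewrite ltr_wpDl.
have cM K v : inJ S K v -> `|c K v| <= (`|M| + 1) * lamKv K v.
  move=> Jv; have l0 := lamKv_gt0 (inJ_nf Jv) (inJ_place Jv).
  have := hM K v Jv; rewrite normrM normfV (gtr0_norm l0) ler_pdivrMr // => h.
  apply: le_trans h _; rewrite ler_pM2r //.
  by apply: le_trans (ler_norm M) _; rewrite lerDl.
exists (e / (`|M| + 1)); rewrite divr_gt0 //; split => // g gL gf.
apply: le_lt_trans (Phi_norm_le cc (ltW M0) cM fL gL) _.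
by rewrite mulrC -ltr_pdivlMr.
Qed.

Lemma indic_supports K v : inJ S K v ->
  supports S K (\1_(Ykv v) : Yt -> RR) [:: v].
Proof.
move=> Jv; have [_ fv] := indic_adapted hS hlam Jv; split => //.
  by move=> w; rewrite inE => /eqP ->.
by move=> w Jw; rewrite fv // inE; case: (eqVneq w v) => // _ /eqP.
Qed.

Lemma Phi_indic c K v : consistent S c -> inJ S K v ->
  Phi S c (\1_(Ykv v) : Yt -> RR) = c K v.
Proof.
move=> cc Jv; have [fK fv] := indic_adapted hS hlam Jv.
rewrite (Phi_supports hS hlam cc fK (indic_supports Jv)) big_seq1 fv //.
by rewrite eqxx mulr1.
Qed.

Lemma indic_sum_inL K r (k : set absv -> RR) : is_number_field K ->
  (forall v, v \in r -> inJ S K v) ->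
  adapted S K (fun y => \sum_(v <- r) k v * \1_(Ykv v) y) /\
  inL S (fun y => \sum_(v <- r) k v * \1_(Ykv v) y).
Proof.
move=> nK rJ.
suff h : adapted S K (fun y => \sum_(v <- r) k v * \1_(Ykv v) y).
  split => //; apply: (adapted_inL hS hlam h) => y nX.
  rewrite big_seq big1 // => v vr; rewrite indicE memNset ?mulr0 // => yv.
  by apply: nX; apply: (inJ_Xs hS (rJ v vr) yv).
elim: r rJ => [|v r IH] rJ.
  under eq_fun do rewrite big_nil.
  split => //; rewrite (_ : [set _ | _] = set0) //.
  apply/seteqP; split => // v [_]; rewrite /fval; case: xgetP => [z _ [y [_ [_ <-]]]|_];
    by rewrite eqxx.
have vJ : inJ S K v by apply: rJ; rewrite mem_head.
have [fK _] := indic_adapted hS hlam vJ.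
have gK := IH (fun w wr => rJ w (mem_behead (s := v :: r) wr)).
have [hK _] := adapted_lin hS hlam (k v) 1 fK gK.
by under eq_fun do rewrite big_cons -[X in _ + X]mul1r.
Qed.

(** [linL] constrains [phi] only on [inL], so each partial sum must be known to lie there before
    linearity applies; the empty sum is handled by the coefficients 0 and 0. *)
Lemma linL_indic_sum phi K r (k : set absv -> RR) : linL S phi ->
  is_number_field K -> (forall v, v \in r -> inJ S K v) ->
  phi (fun y => \sum_(v <- r) k v * \1_(Ykv v) y) =
  \sum_(v <- r) k v * phi (\1_(Ykv v) : Yt -> RR).
Proof.
move=> lphi nK; elim: r => [|v r IH] rJ.
  have [_ h0] := @indic_sum_inL K [::] k nK (fun v => ltac:(by [])).
  have := lphi _ _ 0 0 h0 h0; rewrite !mul0r addr0 big_nil => h; rewrite -[RHS]h.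
  by congr phi; apply/funext => y; rewrite big_nil !mul0r addr0.
have vJ : inJ S K v by apply: rJ; rewrite mem_head.
have rJ' w : w \in r -> inJ S K w by move=> wr; apply: rJ; rewrite inE wr orbT.
have [_ gL] := indic_sum_inL k nK rJ'.
rewrite big_cons -(IH rJ') -[X in _ + X]mul1r -lphi //; last first.
  exact: (indic_inL hS hlam vJ).
by congr phi; apply/funext => y; rewrite big_cons mul1r.
Qed.

Lemma linL_expand phi K f r : linL S phi -> adapted S K f -> inL S f ->
  supports S K f r ->
  phi f = \sum_(v <- r) fval S f v * phi (\1_(Ykv v) : Yt -> RR).
Proof.
move=> lphi fK fL fr; have nK : is_number_field K by case: fK.
rewrite -(linL_indic_sum (fval S f) lphi nK); last by case: fr.
congr phi; apply: (decomposition hS fK _ fr) => y; exact: inL_off.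
Qed.

Lemma contL_bound phi : linL S phi -> contL S lam phi ->
  exists M : RR, forall K v, inJ S K v ->
    `|phi (\1_(Ykv v) : Yt -> RR) / lamKv K v| <= M.
Proof.
move=> lphi cphi.
have [K0 [nK0 _]] := number_field_of_seq [::].
have [_ z0] := @indic_sum_inL K0 [::] (fun=> 0) nK0 (fun v => ltac:(by [])).
have zE : (fun y : Yt => \sum_(v <- [::]) 0 * \1_(Ykv v) y) = fun=> 0 :> RR.
  by apply/funext => y; rewrite big_nil.
rewrite zE in z0.
have phi0 : phi (fun=> 0) = 0.
  have := lphi _ _ 0 0 z0 z0; rewrite !mul0r addr0 => h; rewrite -[RHS]h.
  by congr phi; apply/funext => y; rewrite !mul0r addr0.
have [d [d0 hd]] := cphi _ z0 1 ltr01.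
exists (2 / d) => K v Jv; set g : Yt -> RR := \1_(Ykv v).
have l0 := lamKv_gt0 (inJ_nf Jv) (inJ_place Jv).
have [gK gv] := indic_adapted hS hlam Jv; have gL : inL S g := indic_inL hS hlam Jv.
(* Scaled by [t], the indicator has norm d/2 < d, so [phi] of it is below 1 in absolute value;
   dividing by t * lamKv K v = d/2 yields 2/d, the same bound for all pairs. *)
pose t := d / (2 * lamKv K v).
have t0 : 0 < t by rewrite divr_gt0 // mulr_gt0.
have [hK hv] := adapted_lin hS hlam t 0 gK gK.
have hr := supports_lin t 0 gK gK (indic_supports Jv) (indic_supports Jv).
have h0 y : ~ Xs S y -> t * g y + 0 * g y = 0.
  by move=> nX; rewrite (inL_off gL nX) !mulr0 addr0.
have hL := adapted_inL hS hlam hK h0.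
have := hd _ hL; rewrite phi0 subr0 lphi // mul0r addr0.
have -> : (fun y : Yt => t * g y + 0 * g y - 0) = fun y => t * g y + 0 * g y.
  by apply/funext => y; rewrite subr0.
rewrite (normL_supports hS hlam hK h0 hr) big_seq1 hv // gv // eqxx.
rewrite mulr1 mul0r addr0 (gtr0_norm t0).
have -> : t * lamKv K v = d / 2 by rewrite /t invfM [d * _]mulrA mulfVK // gt_eqF.
have d2 : d / 2 < d by lra.
move=> /(_ d2); rewrite normrM (gtr0_norm t0) => h.
rewrite normrM normfV (gtr0_norm l0) ler_pdivrMr //.
rewrite mulrC -ltr_pdivlMr // in h.
apply: le_trans (ltW h) _; rewrite div1r /t invf_div.
by rewrite mulrAC.
Qed.

(** The ball of a place is the disjoint union of the balls of the places of [L] above it, so its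
    indicator is the sum of theirs and linearity of [phi] does the rest. *)
Lemma indic_consistent phi : linL S phi ->
  consistent S (fun _ v => phi (\1_(Ykv v) : Yt -> RR)).
Proof.
move=> lphi K v L Jv nL KL; have nK := inJ_nf Jv; have pv := inJ_place Jv.
have [fK fv] := indic_adapted hS hlam Jv.
have fL := adapted_extend hS hlam fK nL KL.
have wv w : inJ S L w -> lies_over w v <-> w `<=` v.
  by move=> /inJ_place pw; apply: (lies_overE (subfield_nf nK) (subfield_nf nL) KL pv pw).
set A := [set w | _].
have fA : finite_set A.
  apply: sub_finite_set (finite_above hlam nK nL KL pv) => w [Jw /wv-/(_ Jw) h].
  by split => //; apply: inJ_place Jw.
have valA w : inJ S L w -> w `<=` v -> fval S (\1_(Ykv v) : Yt -> RR) w = 1.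
  by move=> Jw h; rewrite (fval_above hS hlam fK Jv Jw h) fv // eqxx.
have fr : supports S L (\1_(Ykv v) : Yt -> RR) (enum_fset (fset_set A)).
  split; rewrite ?fset_uniq //.
    by move=> w; rewrite in_fset_set // inE => -[].
  move=> w Jw fw; rewrite in_fset_set // inE; split => //; apply/wv => //.
  have [v' Jv' wv'] := inJ_below hS hlam nK KL Jw.
  move: fw; rewrite (fval_above hS hlam fK Jv' Jw wv') fv //.
  by case: (eqVneq v' v) wv' => [->//|_ _ /eqP].
rewrite (linL_expand lphi fL (indic_inL hS hlam Jv) fr).
rewrite (fsbig_finite _ _ fA) /= big_seq [RHS]big_seq; apply: eq_bigr => w.
rewrite in_fset_set // inE => -[Jw /wv-/(_ Jw) h].
by rewrite valA // mul1r.
Qed.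

End Duality.

Theorem theorem1p5
  (S : set (set absv)) (hS : forall u, S u -> is_place Qfield u)
  (lam : {measure set Ymeas -> \bar RR})
  (hlam : forall K v, is_number_field K -> is_place K v ->
            lam (Ykv v : set Ymeas) = (lamKv K v)%:E) :
  [/\ (* Phi' maps J' into L' *)
      (forall c, inJ' S c -> linL S (Phi S c) /\ contL S lam (Phi S c)),
      (* Phi' is linear *)
      (forall c d (a b : RR), inJ' S c -> inJ' S d -> forall f, inL S f ->
          Phi S (fun K v => a * c K v + b * d K v) f
            = a * Phi S c f + b * Phi S d f),
      (* Phi' is injective *)
      (forall c d, inJ' S c -> inJ' S d ->
          (forall f, inL S f -> Phi S c f = Phi S d f) ->
          forall K v, inJ S K v -> c K v = d K v) &
      (* Phi' is surjective *)
      (forall phi, linL S phi -> contL S lam phi ->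
          exists c, inJ' S c /\ forall f, inL S f -> Phi S c f = phi f)].
Proof.
split.
- move=> c Jc; split; last exact: Phi_contL.
  by apply: (Phi_linL hS hlam); case: Jc.
- move=> c d a b [cc _] [cd _] f fL; have [K fK] := exists_adapted hlam fL.
  have [r [fr _]] := exists_supports2 fK fK.
  rewrite (Phi_supports hS hlam (consistent_lin hlam a b cc cd) fK fr).
  rewrite (Phi_supports hS hlam cc fK fr) (Phi_supports hS hlam cd fK fr).
  rewrite !mulr_sumr -big_split /=; apply: eq_bigr => v _.
  by rewrite mulrDl !mulrA.
- move=> c d [cc _] [cd _] cE K v Jv.
  rewrite -(Phi_indic hS hlam cc Jv) -(Phi_indic hS hlam cd Jv).
  by apply: cE; apply: (indic_inL hS hlam Jv).
- move=> phi lphi cphi.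
  (* These values are forced by [Phi_indic]; the field argument does not enter, since the ball
     depends on the place alone. *)
  exists (fun _ v => phi (\1_(Ykv v) : Yt -> RR)).
  have cc := indic_consistent hS hlam lphi.
  split; first by split => //; apply: (contL_bound hS hlam lphi cphi).
  move=> f fL; have [K fK] := exists_adapted hlam fL.
  have [r [fr _]] := exists_supports2 fK fK.
  rewrite (Phi_supports hS hlam cc fK fr) (linL_expand hS hlam lphi fK fL fr).
  by apply: eq_bigr => v _; rewrite mulrC.
Qed.
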